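(* Let $G$, $H$ be two graphs with $\mathrm{CDC}(G)\simeq \mathrm{CDC}(H)$, and let $k$ be a natural number. Then, for an appropriate labelling of the vertices (i.e. after suitably relabelling the vertices of one of the graphs, equivalently, after permuting the rows of one of the matrices by a suitable permutation), $\mathbf W_G(k) = \mathbf W_H(k)$.
   Context: All graphs are finite, simple and undirected (no loops or multiple edges), with vertex set $\mathcal V=\{1,\dots,n\}$ and edge set $\mathcal E$. The adjacency matrix $\mathbf A=\mathbf A(G)$ is the symmetric $n\times n$ $(0,1)$-matrix with $(i,j)$ entry $1$ iff $\{i,j\}\in\mathcal E$. The canonical double covering $\mathrm{CDC}(G)$ of $G=(\mathcal V,\mathcal E)$ is the graph with vertex set $\mathcal V\times\{0,1\}$ and edge set $\{\{(u,0),(v,1)\},\{(u,1),(v,0)\} : \{u,v\}\in\mathcal E\}$. $\simeq$ denotes graph isomorphism. Let $\mathbf j=(1,\dots,1)^T$ be the all-ones column vector. The $k$-walk matrix $\mathbf W_G(k)$ is the $n\times k$ matrix whose columns are $\mathbf j,\mathbf A\mathbf j,\mathbf A^2\mathbf j,\dots,\mathbf A^{k-1}\mathbf j$. *)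

(* Defs.v *)
From mathcomp Require Import all_boot all_order all_algebra.

Set Implicit Arguments.
Unset Strict Implicit.
Unset Printing Implicit Defensive.

Import GRing.Theory.
Local Open Scope ring_scope.

Record sgraph (T : finType) := SGraph {
  adj :> rel T;
  adj_sym : symmetric adj;
  adj_irr : irreflexive adj
}.

Definition graph_iso (T U : finType) (G : sgraph T) (H : sgraph U) : Prop :=
  exists f : T -> U, bijective f /\ forall x y, H (f x) (f y) = G x y.

(* Canonical double covering: [false] and [true] stand for the layers 0 and 1. *)
Section CDC.
Variables (T : finType) (G : sgraph T).

Definition cdc_adj : rel (T * bool) :=
  [rel x y | G x.1 y.1 && (x.2 != y.2)].

Lemma cdc_adj_sym : symmetric cdc_adj.
Proof. by move=> x y; rewrite /cdc_adj /= (adj_sym G) eq_sym. Qed.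

Lemma cdc_adj_irr : irreflexive cdc_adj.
Proof. by move=> x; rewrite /cdc_adj /= (adj_irr G). Qed.

Definition CDC : sgraph (T * bool)%type := SGraph cdc_adj_sym cdc_adj_irr.

End CDC.

(* The graph on [U] obtained from [G] by giving the vertex [f u] the label [u];
   this is a relabelling of [G] when [f] is bijective. *)
Section Relabel.
Variables (T U : finType) (f : U -> T) (G : sgraph T).

Definition relabel_adj : rel U := [rel u v | G (f u) (f v)].

Lemma relabel_adj_sym : symmetric relabel_adj.
Proof. by move=> u v; exact: adj_sym. Qed.

Lemma relabel_adj_irr : irreflexive relabel_adj.
Proof. by move=> u; exact: adj_irr. Qed.

Definition relabel : sgraph U := SGraph relabel_adj_sym relabel_adj_irr.

End Relabel.

Definition adjmx (n : nat) (G : sgraph 'I_n) : 'M[int]_n :=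
  \matrix_(i, j) (G i j)%:R.

(* Column [l] (counted from 0) is [A ^+ l *m j], with [j] the all-ones vector. *)
Definition walkmx (n : nat) (G : sgraph 'I_n) (k : nat) : 'M[int]_(n, k) :=
  \matrix_(i < n, l < k) (adjmx G ^+ l *m (const_mx 1 : 'cV[int]_n)) i 0.

(* Main.v *)
Require Import Defs.
From mathcomp Require Import all_boot all_order all_algebra.
From mathcomp Require Import perm.

(** A walk of CDC(G) starting at (u, b) is determined by its projection to G,
    so (u, b) and u start equally many walks of each length. Thus every list of
    walk counts is realised by exactly twice as many vertices of CDC(G) as of G.
    An isomorphism preserves walk counts, so, dividing by 2, every row occurs
    equally often in the walk matrices of G and H. *)

Set Implicit Arguments.
Unset Strict Implicit.
Unset Printing Implicit Defensive.

Import GRing.Theory.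

(** Stated over any [finType] so that it also counts walks in [CDC G], whose vertices are not
    ordinals. *)
Fixpoint walks (T : finType) (G : sgraph T) (l : nat) (x : T) : nat :=
  if l is l'.+1 then \sum_(y | G x y) walks G l' y else 1.

Lemma walks_iso (T U : finType) (G : sgraph T) (H : sgraph U) (f : T -> U) :
    bijective f -> (forall x y, H (f x) (f y) = G x y) ->
  forall l x, walks H l (f x) = walks G l x.
Proof.
move=> f_bij fE; elim=> [//|l IHl] x /=.
rewrite (reindex f) /=; last exact: onW_bij.
by apply: eq_big => y // _; rewrite IHl.
Qed.

Lemma walks_CDC (T : finType) (G : sgraph T) l (x : T * bool) :
  walks (CDC G) l x = walks G l x.1.
Proof.
elim: l x => [//|l IHl] [x b] /=.
under eq_bigr do rewrite IHl.
rewrite -(pair_big (G x) (fun c => b != c) (fun y _ => walks G l y)) /=.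
(* Each neighbour [y] has a single lift adjacent to [(x, b)], the one in layer [~~ b]. *)
by apply: eq_bigr => y _; rewrite (big_pred1 (~~ b)) // => c; case: b c => [] [].
Qed.

Lemma walkmxE n (G : sgraph 'I_n) k i (l : 'I_k) :
  walkmx G k i l = (walks G l i)%:R%R.
Proof.
rewrite mxE; case: l => /= l _; elim: l i => [|l IHl] i.
  by rewrite expr0 mul1mx mxE.
rewrite exprS -mulmxA mxE natr_sum [RHS]big_mkcond /=.
apply: eq_bigr => j _; rewrite IHl mxE.
by case: (G i j); rewrite ?mul1r ?mul0r.
Qed.

Lemma sum_fst_bool (T : finType) (F : T -> nat) :
  \sum_(x : T * bool) F x.1 = (\sum_x F x).*2.
Proof.
rewrite -(pair_bigA _ (fun x _ => F x)) /= -mul2n big_distrr /=.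
by apply: eq_bigr => x _; rewrite sum_nat_const card_bool.
Qed.

(** Equal counts make the value lists of [p] and [q] permutations of each other; the permutation is
    the bijection. *)
Lemma matching_bijection n m (P : eqType) (p : 'I_n -> P) (q : 'I_m -> P) :
    (forall a : pred P, \sum_i a (p i) = \sum_j a (q j)) ->
  exists f : 'I_m -> 'I_n, bijective f /\ forall j, p (f j) = q j.
Proof.
move=> pqE; have nm : n = m.
  (* The constantly true predicate counts the indices. *)
  by have := pqE predT; rewrite !sum_nat_const !card_ord !muln1.
case: m / nm q pqE => q pqE.
have /tuple_permP[s sE] : perm_eq (mktuple q) (mktuple p).
  apply/seq.permP=> a; rewrite -!sum1_count !big_map -!enumT.
  rewrite !big_enum_cond [LHS]big_mkcond [RHS]big_mkcond.
  exact/esym/pqE.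
exists s; split; first by exists (s^-1)%g; [exact: permK | exact: permKV].
move=> j; have := congr1 (fun t => tnth t j) (val_inj sE).
by rewrite !tnth_mktuple.
Qed.

Theorem theorem3p3 (n m : nat) (G : sgraph 'I_n) (H : sgraph 'I_m)
    (hCDC : graph_iso (CDC G) (CDC H)) (k : nat) :
  exists f : 'I_m -> 'I_n, bijective f /\ walkmx (relabel f G) k = walkmx H k.
Proof.
case: hCDC => phi [phi_bij phiE].
pose prof n (G : sgraph 'I_n) i := mkseq (fun l => walks G l i) k.
have prof_iso x : prof m H (phi x).1 = prof n G x.1.
  by apply: eq_map => l; rewrite -!walks_CDC (walks_iso phi_bij phiE).
have [a|f [f_bij fE]] := @matching_bijection n m _ (prof n G) (prof m H).
  (* Doubled, both counts run over the double coverings, where [phi] matches them. *)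
  apply: double_inj; rewrite -!sum_fst_bool [RHS](reindex phi) /=.
    by apply: eq_bigr => x _; rewrite prof_iso.
  exact: onW_bij.
exists f; split=> //; apply/matrixP=> i l; rewrite !walkmxE.
(* By construction [f] is an isomorphism from [relabel f G] to [G]. *)
rewrite -(walks_iso (G := relabel f G) (H := G) f_bij) //.
(* The default 0 is never read, since [l < k]. *)
have := congr1 (fun s => nth 0 s l) (fE i).
by rewrite !nth_mkseq // => ->.
Qed.
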